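(* Let $d\ge 1$, $Q>0$, $R>0$. For $g_r,g_f\in\mathbb{R}^d$ with $Q\le R\|g_f\|$ let $$F_r^*(g_r,g_f) := \min\{\, g_r\cdot \Delta w \;:\; \Delta w\in\mathbb{R}^d,\ g_f\cdot \Delta w \ge Q,\ \|\Delta w\|\le R \,\}.$$ Then, for fixed $\|g_r\|$ and $\|g_f\|$, $F_r^*$ is monotonically non-decreasing in $\kappa := g_r\cdot g_f$. That is, if $g_r,g_f,g_r',g_f'\in\mathbb{R}^d$ satisfy $\|g_r\|=\|g_r'\|$, $\|g_f\|=\|g_f'\|$, $Q\le R\|g_f\|$, and $g_r\cdot g_f\le g_r'\cdot g_f'$, then $F_r^*(g_r,g_f)\le F_r^*(g_r',g_f')$.
   Context: $\cdot$ is the Euclidean inner product and $\|\cdot\|$ the Euclidean norm on $\mathbb{R}^d$. In the application, $g_r$ and $g_f$ are the gradients of the average loss on the retain data and the forget data, $F_r^*$ is the minimum cost of forgetting, and $\kappa$ is called the hardness measure; the statement uses $g_r,g_f$ only as vectors in $\mathbb{R}^d$. *)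

(* Defs.v *)
From mathcomp Require Import all_boot all_order all_algebra.
From mathcomp Require Import boolp classical_sets reals.

Set Implicit Arguments.
Unset Strict Implicit.
Unset Printing Implicit Defensive.

Import Order.TTheory GRing.Theory Num.Theory.
Local Open Scope classical_set_scope.
Local Open Scope ring_scope.

Definition dot (K : realType) (d : nat) (u v : 'rV[K]_d) : K :=
  \sum_(i < d) u 0 i * v 0 i.

(* The library's norm on 'rV[K]_d is the sup norm, hence this definition. *)
Definition enorm (K : realType) (d : nat) (u : 'rV[K]_d) : K :=
  Num.sqrt (dot u u).

Definition is_min (K : realType) (A : set K) (m : K) : Prop :=
  A m /\ lbound A m.

Definition feasible (K : realType) (d : nat) (Q R : K) (gf : 'rV[K]_d) :
    set 'rV[K]_d :=
  [set dw | Q <= dot gf dw /\ enorm dw <= R].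

Definition costs (K : realType) (d : nat) (Q R : K) (gr gf : 'rV[K]_d) :
    set K :=
  [set dot gr dw | dw in feasible Q R gf].

(* The default value 0 is taken only when the set of costs has no minimum. *)
Definition Fr_star (K : realType) (d : nat) (Q R : K) (gr gf : 'rV[K]_d) : K :=
  xget 0 [set m | is_min (costs Q R gr gf) m].

(* Main.v *)
Require Import Defs.
From mathcomp Require Import all_boot all_order all_algebra.
From mathcomp Require Import boolp classical_sets reals.
From mathcomp Require Import ring lra.

Set Implicit Arguments.
Unset Strict Implicit.
Unset Printing Implicit Defensive.

Import Order.TTheory GRing.Theory Num.Theory.
Local Open Scope ring_scope.

(** Lagrange duality. If [gr = l gf - m w] with [l, m >= 0] and complementary
    slackness, then for every feasible [w'] of a problem with the same norms,
      [gr'.w' = l gf'.w' + (gr' - l gf').w' >= l Q - R |gr' - l gf'|],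
    and [|gr' - l gf'|^2 = |gr|^2 - 2 l kappa' + l^2 |gf|^2] is non-increasing
    in [kappa'] because [l >= 0]. So the optimal cost [l Q - m R^2] of the
    smaller [kappa] bounds from below every cost of the larger one; taking
    [(gr', gf') = (gr, gf)], the same inequality gives optimality of [w].
    Multipliers exist unless [Q = R |gf|], where the feasible set is the single
    point [(Q / |gf|^2) gf]. *)

Section Dot.
Variables (K : realType) (d : nat).
Implicit Types (u v w : 'rV[K]_d) (a : K).

Lemma dotC u v : dot u v = dot v u.
Proof. by apply: eq_bigr => i _; rewrite mulrC. Qed.

Lemma dotDr u v w : dot u (v + w) = dot u v + dot u w.
Proof.
by rewrite /dot -big_split; apply: eq_bigr => i _; rewrite mxE mulrDr.
Qed.

Lemma dotZr a u v : dot u (a *: v) = a * dot u v.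
Proof.
by rewrite /dot mulr_sumr; apply: eq_bigr => i _; rewrite mxE mulrCA.
Qed.

Lemma dotDl u v w : dot (u + v) w = dot u w + dot v w.
Proof. by rewrite dotC dotDr !(dotC w). Qed.

Lemma dotZl a u v : dot (a *: u) v = a * dot u v.
Proof. by rewrite dotC dotZr dotC. Qed.

Definition dotE := (dotDl, dotDr, dotZl, dotZr).

Lemma dot_ge0 u : 0 <= dot u u.
Proof. by apply: sumr_ge0 => i _; rewrite -expr2 sqr_ge0. Qed.

Lemma dot_le0_eq0 u : dot u u <= 0 -> u = 0.
Proof.
move=> u_le0; apply/rowP => i; rewrite mxE.
have /eqP : dot u u = 0 by apply/le_anti; rewrite u_le0 dot_ge0.
rewrite psumr_eq0 => [/allP/(_ i)|j _]; last by rewrite -expr2 sqr_ge0.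
by rewrite mem_index_enum mulf_eq0 orbb => /(_ isT)/eqP.
Qed.

Lemma dot0l u : dot 0 u = 0.
Proof. by rewrite -(scale0r 0) dotZl mul0r. Qed.

Lemma enorm_eq_dot u v : enorm u = enorm v -> dot u u = dot v v.
Proof.
by move=> uv; rewrite -(sqr_sqrtr (dot_ge0 u)) [Num.sqrt _]uv sqr_sqrtr ?dot_ge0.
Qed.

Lemma enorm_le u a : 0 <= a -> (enorm u <= a) = (dot u u <= a ^+ 2).
Proof.
move=> a0; rewrite -[dot u u]sqr_sqrtr ?dot_ge0 //.
by rewrite ler_pXn2r // nnegrE sqrtr_ge0.
Qed.

(** Cauchy-Schwarz in square-root-free form, read off from [0 <= |u + m w|^2]; the case [m = 0] is
    separate, since there [u] vanishes. *)
Lemma dot_lower_bound u w (m r : K) :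
  0 <= m -> dot u u <= m * (m * r) -> dot w w <= r -> - (m * r) <= dot u w.
Proof.
rewrite le_eqVlt => /predU1P[<-|m_gt0] u_le wr.
  by move: u_le; rewrite !mul0r => /dot_le0_eq0 ->; rewrite dot0l oppr0.
rewrite -(ler_pM2l m_gt0).
have := dot_ge0 (u + m *: w); rewrite !dotE (dotC w u).
have := ler_wpM2l (ltW m_gt0) (ler_wpM2l (ltW m_gt0) wr); lra.
Qed.

End Dot.

Section Optimum.
Variables (K : realType) (d : nat) (Q R : K).
Hypotheses (Q_gt0 : 0 < Q) (R_gt0 : 0 < R).
Implicit Types gr gf w : 'rV[K]_d.

Lemma feasibleP gf w :
  feasible Q R gf w <-> Q <= dot gf w /\ dot w w <= R ^+ 2.
Proof. rewrite -(enorm_le _ (ltW R_gt0)); exact: iff_refl. Qed.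

Lemma kkt_lower_bound gr gf w (l m : K) gr' gf' w' :
  0 <= l -> 0 <= m -> gr = l *: gf - m *: w ->
  l * (dot gf w - Q) = 0 -> m * (dot w w - R ^+ 2) = 0 ->
  dot gr gr = dot gr' gr' -> dot gf gf = dot gf' gf' ->
  dot gr gf <= dot gr' gf' -> feasible Q R gf' w' ->
  dot gr w <= dot gr' w'.
Proof.
move=> l0 m0 grE lQ mR grr gff kk /feasibleP[Qw' w'R].
set u := gr' - l *: gf'.
have u_le : dot u u <= m * (m * R ^+ 2).
  (* Slackness lets [|w|^2] replace [R ^+ 2] under the factor [m], with no case split on [m = 0]. *)
  have -> : m * (m * R ^+ 2) = m * (m * dot w w).
    by congr (m * _); apply/eqP; rewrite -subr_eq0 -mulrBr -opprB mulrN mR oppr0.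
  have <- : dot (gr - l *: gf) (gr - l *: gf) = m * (m * dot w w).
    rewrite {1 2}grE addrAC subrr add0r -scaleNr !dotE; ring.
  rewrite /u -!scaleNr !dotE -grr -gff (dotC gf) (dotC gf').
  have := ler_wpM2l l0 kk; lra.
have uw' := dot_lower_bound m0 u_le w'R.
have -> : gr' = l *: gf' + u by rewrite /u addrC subrK.
clearbody u.
rewrite grE -scaleNr !dotE; have := ler_wpM2l l0 Qw'; lra.
Qed.

(** The strict inequality is Slater's condition. The cases follow the active constraints: ball only,
    half-space only, or both. *)
Lemma kkt_exists gr gf : Q ^+ 2 < R ^+ 2 * dot gf gf ->
  exists w l m, [/\ feasible Q R gf w, 0 <= l, 0 <= m,
    gr = l *: gf - m *: w &
    l * (dot gf w - Q) = 0 /\ m * (dot w w - R ^+ 2) = 0].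
Proof.
set A := dot gr gr; set B := dot gf gf; set k := dot gr gf => QB.
have R2 : 0 < R ^+ 2 by rewrite exprn_gt0.
have B_gt0 : 0 < B.
  by rewrite -(pmulr_rgt0 _ R2); apply: le_lt_trans QB; rewrite sqr_ge0.
have B0 : B != 0 by rewrite gt_eqF.
have [/andP[k0 QA]|not_deep] := boolP ((k < 0) && (Q ^+ 2 * A <= R ^+ 2 * k ^+ 2)).
  have A_gt0 : 0 < A.
    rewrite lt_neqAle dot_ge0 andbT eq_sym; apply: contraTneq k0 => A0.
    have gr0 : gr = 0 by apply: dot_le0_eq0; rewrite -/A A0.
    by rewrite /k gr0 dot0l ltxx.
  set a := Num.sqrt A; have a_gt0 : 0 < a by rewrite sqrtr_gt0.
  have a0 : a != 0 by rewrite gt_eqF.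
  have R0 : R != 0 by rewrite gt_eqF.
  have aA : a ^+ 2 = A by rewrite sqr_sqrtr // ltW.
  (* The minimizer over the whole ball, [- R gr / |gr|], already lies in the half-space, so
     [l = 0]. *)
  exists (- (R / a) *: gr), 0, (a / R).
  have ww : dot (- (R / a) *: gr) (- (R / a) *: gr) = R ^+ 2.
    by rewrite !dotE -/A -aA; field.
  split => //; last 2 first.
  - rewrite scale0r add0r scalerA mulrN scaleNr opprK mulrA.
    by rewrite divfK // divff // scale1r.
  - by rewrite ww subrr mulr0 mul0r.
  - apply/feasibleP; rewrite ww; split => //.
    rewrite dotE (dotC gf) -/k mulNr -mulrN mulrAC ler_pdivlMr //.
    have Rk : 0 <= R * - k by rewrite mulr_ge0 ?ltW ?oppr_gt0.
    rewrite -(ler_pXn2r (n := 2)) // ?nnegrE ?mulr_ge0 ?(ltW Q_gt0) ?(ltW a_gt0) //.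
    by rewrite !exprMn aA sqrrN.
  - by rewrite divr_ge0 ?ltW.
(* The component of [gr] orthogonal to [gf]. *)
set v := gr - (k / B) *: gf.
have grE : gr = (k / B) *: gf + v by rewrite /v addrC subrK.
have gfv : dot gf v = 0.
  by rewrite /v -scaleNr !dotE (dotC gf) -/k -/B; field.
have vv : dot v v = A - k ^+ 2 / B.
  by rewrite /v -scaleNr !dotE (dotC gf gr) -/k -/A -/B; field.
clearbody v.
have [v0|v_neq0] := eqVneq v 0.
  have k0 : 0 <= k.
    (* If [gr] were a negative multiple of [gf], then [A = k^2 / B], and Slater's condition would
       put us in the first case. *)
    rewrite leNgt; apply: contra not_deep => k0; rewrite k0 /=.
    have -> : A = k ^+ 2 / B.
      by apply/eqP; rewrite -subr_eq0 -vv v0 dot0l.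
    by rewrite mulrA ler_pdivrMr // [leRHS]mulrAC ler_wpM2r ?sqr_ge0 // ltW.
  have gfw : dot gf ((Q / B) *: gf) = Q by rewrite dotE -/B divfK.
  exists ((Q / B) *: gf), (k / B), 0; split => //.
  - apply/feasibleP; rewrite gfw; split => //.
    by rewrite dotZl gfw mulrAC -expr2 ler_pdivrMr // ltW.
  - by rewrite divr_ge0 // ltW.
  - by rewrite scale0r subr0 {1}grE v0 addr0.
  - by rewrite gfw subrr mulr0 mul0r.
have V_gt0 : 0 < dot v v.
  rewrite lt_neqAle dot_ge0 andbT eq_sym; apply: contra v_neq0 => /eqP V0.
  by apply/eqP/dot_le0_eq0; rewrite V0.
(* Both constraints active: [(Q / B) gf] meets the half-space with equality, and [S] is the squared
   length left for the step [t] along [- v] to reach the sphere. *)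
set S := R ^+ 2 - Q ^+ 2 / B.
have S_gt0 : 0 < S by rewrite subr_gt0 ltr_pdivrMr.
set t := Num.sqrt (S / dot v v).
have t_gt0 : 0 < t by rewrite sqrtr_gt0 divr_gt0.
have t0 : t != 0 by rewrite gt_eqF.
have tV : t ^+ 2 * dot v v = S.
  by rewrite sqr_sqrtr ?divfK ?gt_eqF // ltW // divr_gt0.
set w := (Q / B) *: gf - t *: v.
have gfw : dot gf w = Q by rewrite /w -scaleNr !dotE gfv -/B; field.
have ww : dot w w = R ^+ 2.
  rewrite /w -scaleNr !dotE (dotC v gf) gfv -/B.
  have -> : Q / B * (Q / B * B + - t * 0) +
      (Q / B * (- t * 0) + - t * (- t * dot v v))
    = Q ^+ 2 / B + t ^+ 2 * dot v v by field.
  by rewrite tV /S addrC subrK.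
(* The multipliers come from matching the coefficients of [v] and [gf] in [gr = l gf - m w]. *)
exists w, ((k * t + Q) / (t * B)), t^-1; split.
- by apply/feasibleP; rewrite gfw ww.
- rewrite divr_ge0 //; last by rewrite ltW // mulr_gt0.
  have [k0|k0] := leP 0 k; first by rewrite addr_ge0 ?mulr_ge0 // ltW.
  move: not_deep; rewrite k0 /= -ltNge => /ltW QA.
  (* Squared and multiplied by [|v|^2], this becomes [R^2 k^2 <= Q^2 A], which failure of the first
     case supplies. *)
  have : - k * t <= Q.
    rewrite -(ler_pXn2r (n := 2)) // ?nnegrE ?(ltW Q_gt0) //;
      last by rewrite mulr_ge0 ?oppr_ge0 ?(ltW k0) ?(ltW t_gt0).
    rewrite exprMn sqrrN -(ler_pM2r V_gt0) -mulrA tV vv /S.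
    lra.
  lra.
- by rewrite invr_ge0 ltW.
- rewrite /w scalerBr !scalerA mulVf // scale1r opprB addrCA -scalerBl.
  rewrite [LHS]grE [LHS]addrC; congr (_ + _ *: _); field; exact/andP.
- by rewrite gfw ww !subrr !mulr0.
Qed.

(** Equality case of Cauchy-Schwarz: the constraints force [|w - (Q / B) gf|^2 <= 0]. *)
Lemma feasible_boundary gf w : Q ^+ 2 = R ^+ 2 * dot gf gf ->
  feasible Q R gf w <-> w = (Q / dot gf gf) *: gf.
Proof.
set B := dot gf gf => QB.
have R2 : 0 < R ^+ 2 by rewrite exprn_gt0.
have B_gt0 : 0 < B by rewrite -(pmulr_rgt0 _ R2) -QB exprn_gt0.
have B0 : B != 0 by rewrite gt_eqF.
have RB : R ^+ 2 = Q ^+ 2 / B by rewrite QB mulfK.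
split=> [/feasibleP[Qw wR]|->]; last first.
  apply/feasibleP; rewrite !dotE -/B divfK //; split=> //.
  by rewrite RB mulrAC -expr2.
apply/eqP; rewrite -subr_eq0; apply/eqP/dot_le0_eq0.
rewrite -scaleNr !dotE (dotC w) -/B.
have QB0 : 0 <= Q / B by rewrite divr_ge0 // ltW.
have := ler_wpM2l QB0 Qw.
have -> : Q / B * Q = Q ^+ 2 / B by field.
have -> : - (Q / B) * (- (Q / B) * B) = Q ^+ 2 / B by field.
move: wR; rewrite RB; lra.
Qed.

Lemma minimizer_exists gr gf : Q <= R * enorm gf ->
  exists2 w, feasible Q R gf w & forall gr' gf' w',
    dot gr gr = dot gr' gr' -> dot gf gf = dot gf' gf' ->
    dot gr gf <= dot gr' gf' -> feasible Q R gf' w' -> dot gr w <= dot gr' w'.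
Proof.
move=> Q_le.
have : Q ^+ 2 <= R ^+ 2 * dot gf gf.
  rewrite -[dot gf gf]sqr_sqrtr ?dot_ge0 // -exprMn.
  by rewrite ler_pXn2r // ?nnegrE ?mulr_ge0 ?sqrtr_ge0 ?(ltW Q_gt0) ?(ltW R_gt0).
rewrite le_eqVlt => /predU1P[QB|QB]; last first.
  have [w [l [m [fw l0 m0 grE [lQ mR]]]]] := @kkt_exists gr gf QB.
  exists w => // gr' gf' w'; exact: kkt_lower_bound l0 m0 grE lQ mR.
(* Both feasible sets are singletons, and the cost is [Q / |gf|^2] times [kappa]. *)
exists ((Q / dot gf gf) *: gf); first exact/feasible_boundary.
move=> gr' gf' w' _ gff kk.
rewrite feasible_boundary -?gff // => ->.
by rewrite !dotZr ler_wpM2l // divr_ge0 ?dot_ge0 ?ltW.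
Qed.

(** An explicit minimizer rules out the default value of [xget]; antisymmetry makes the minimum
    unique. *)
Lemma Fr_star_eq gr gf w : feasible Q R gf w ->
  (forall w', feasible Q R gf w' -> dot gr w <= dot gr w') ->
  is_min (costs Q R gr gf) (Fr_star Q R gr gf) /\
  Fr_star Q R gr gf = dot gr w.
Proof.
move=> fw w_min.
have mw : is_min (costs Q R gr gf) (dot gr w).
  by split; [exists w | move=> _ [w' fw' <-]; apply: w_min].
have mF : is_min (costs Q R gr gf) (Fr_star Q R gr gf).
  exact: (xgetPex (P := is_min (costs Q R gr gf)) 0 (ex_intro _ _ mw)).
by split=> //; apply/le_anti; rewrite mF.2 ?mw.2 //; [exact: mF.1 | exact: mw.1].
Qed.

End Optimum.

Theorem corollary4p2 (K : realType) (d : nat) (Q R : K)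
    (gr gf gr' gf' : 'rV[K]_d)
    (d_ge1 : (1 <= d)%N) (Q_gt0 : 0 < Q) (R_gt0 : 0 < R)
    (gr_norm : enorm gr = enorm gr') (gf_norm : enorm gf = enorm gf')
    (Q_le : Q <= R * enorm gf)
    (kappa_le : dot gr gf <= dot gr' gf') :
  [/\ is_min (costs Q R gr gf) (Fr_star Q R gr gf),
      is_min (costs Q R gr' gf') (Fr_star Q R gr' gf') &
      Fr_star Q R gr gf <= Fr_star Q R gr' gf'].
Proof.
have Q_le' : Q <= R * enorm gf' by rewrite -gf_norm.
have [w fw w_min] := minimizer_exists Q_gt0 R_gt0 gr Q_le.
have [w' fw' w'_min] := minimizer_exists Q_gt0 R_gt0 gr' Q_le'.
have [mF FE] :=
  Fr_star_eq fw (fun u => w_min gr gf u erefl erefl (lexx _)).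
have [mF' FE'] :=
  Fr_star_eq fw' (fun u => w'_min gr' gf' u erefl erefl (lexx _)).
split=> //; rewrite FE FE'.
exact: (w_min _ _ _ (enorm_eq_dot gr_norm) (enorm_eq_dot gf_norm) kappa_le fw').
Qed.
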